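(* For integers $n,k$ with $n\ge 2$ and $1\le k<2^{n-1}$, the number $\sigma_{n,k}$ of separating families of $k$ proper bipartitions over an $n$-element set is $$\sigma_{n,k}=\sum_{i=1}^{n-1}(-1)^{n-1-i}\left[{n \atop i+1}\right]\binom{2^i-1}{k}.$$
   Context: A bipartition of a set $S$ is a partition of $S$ into at most two nonempty components; it is proper if it has exactly two components. A bipartition cuts two elements if they lie in different components. A family of bipartitions of $S$ is a separating family for $S$ if every two distinct elements of $S$ are cut by some bipartition in the family. $\sigma_{n,k}$ is the number of separating families consisting of $k$ distinct proper bipartitions of a fixed $n$-element set. $\left[{a \atop b}\right]$ denotes the unsigned Stirling number of the first kind (number of permutations of $a$ elements with exactly $b$ cycles). *)

(* Defs.v *)
From HB Require Import structures.
From mathcomp Require Import all_boot all_order all_algebra all_fingroup.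

Set Implicit Arguments.
Unset Strict Implicit.
Unset Printing Implicit Defensive.

Section Bipartitions.
Variable T : finType.
Implicit Types (P : {set {set T}}) (F : {set {set {set T}}}).

(* [partition] already requires the blocks to be nonempty. *)
Definition bipartition P := partition P [set: T] && (#|P| <= 2).

Definition proper_bipartition P := bipartition P && (#|P| == 2).

Definition cuts P (x y : T) := pblock P x != pblock P y.

Definition separating_family F :=
  [forall P in F, bipartition P] &&
  [forall x : T, forall y : T, (x != y) ==> [exists P in F, cuts P x y]].

Definition sigma (k : nat) : nat :=
  #|[set F | [&& separating_family F,
                 [forall P in F, proper_bipartition P] & #|F| == k]]|.

End Bipartitions.

(* Fixed points count as cycles: [porbits s] includes the singleton orbits. *)
Definition stirling1 (a b : nat) : nat := #|[set s : 'S_a | #|porbits s| == b]|.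

(* Main.v *)
(** Fix a set [F] of bipartitions.  The permutations all of whose cycles stay
    inside the classes of points that [F] does not cut form a Young subgroup;
    the sum of their signs is 1 if [F] is separating (only the identity is
    left) and 0 otherwise (the subgroup contains a transposition).  Exchanging
    the two sums, [sigma T k] becomes the signed sum over all permutations [s]
    of the number of [k]-sets of proper bipartitions that do not cut any cycle
    of [s]; there are [2 ^ (c - 1) - 1] such bipartitions when [s] has [c]
    cycles, and the sign of [s] is [(-1) ^ (n - c)]. *)
Require Import Defs.
From HB Require Import structures.
From mathcomp Require Import all_boot all_order all_algebra all_fingroup.
From mathcomp Require Import zify.

Set Implicit Arguments.
Unset Strict Implicit.
Unset Printing Implicit Defensive.

Import Order.TTheory GRing.Theory Num.Theory.
Local Open Scope ring_scope.

Lemma sum_sign_fiber_perm (T : finType) (S : eqType) (f : T -> S) :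
  \sum_(s : {perm T} | [forall x, f (s x) == f x]) (-1) ^+ s
    = (injectiveb f)%:R :> int.
Proof.
case: (boolP (injectiveb f)) => [/injectiveP f_inj | /injectivePn[x [y xy fxy]]].
  rewrite (big_pred1 1%g) ?odd_perm1 // => s.
  apply/forallP/eqP => [fs | -> x]; last by rewrite perm1.
  by apply/permP => x; rewrite perm1; apply: f_inj; apply/eqP.
(* Since [f] is unchanged by [tperm x y], multiplication by this transposition permutes the index
   set and flips every sign, so the sum equals its own negative. *)
set A := \sum_(s | _) _; suff: A = - A by lia.
have ft z : f (tperm x y z) = f z by case: tpermP => [->|->|].
rewrite {1}/A (reindex_inj (mulgI (tperm x y))) /= /A -sumrN.
apply: eq_big => [s | s _]; last first.
  by rewrite odd_mul_tperm xy signr_addb mulN1r.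
apply/forallP/forallP => fs z.
  by have:= fs (tperm x y z); rewrite permM tpermK ft.
by rewrite permM (eqP (fs _)) ft.
Qed.

Section UncutBipartitions.
Variable T : finType.
Implicit Types (s : {perm T}) (F : {set {set {set T}}}) (P : {set {set T}}).

(** Comparing each point only with its image under [s] is enough: following the iterates of [s],
    this keeps every cycle inside one block. *)
Definition uncut_bipartitions s : {set {set {set T}}} :=
  [set P | proper_bipartition P & [forall x, ~~ cuts P (s x) x]].

(** Two points have the same tuple of blocks exactly when no member of [F] cuts them. The dummy
    value [set0] outside [F] gives the tuples for all [F] one common type, and injectivity is the
    form in which the signed sum detects separation. *)
Lemma separating_injective F :
    [forall P in F, proper_bipartition P] ->
  separating_family F =
    injectiveb (fun x => [ffun P => if P \in F then pblock P x else set0]).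
Proof.
move=> /forall_inP propF; rewrite /separating_family.
have -> /= : [forall P in F, bipartition P].
  by apply/forall_inP => P /propF /andP[].
apply/forallP/injectiveP => [sep x y /ffunP exy | f_inj x].
  apply/eqP; apply: contraT => xy.
  have /exists_inP[P PF] := implyP (forallP (sep x) y) xy.
  by rewrite /cuts; have := exy P; rewrite !ffunE PF => ->; rewrite eqxx.
apply/forallP => y; apply/implyP => xy; apply: contraT => /exists_inPn nc.
rewrite -(negbTE xy); apply/eqP/f_inj/ffunP => P; rewrite !ffunE.
by case: ifP => // /nc; rewrite negbK => /eqP.
Qed.

Lemma sigma_sum_perm k :
  (sigma T k)%:Z =
    \sum_(s : {perm T}) (-1) ^+ s * ('C(#|uncut_bipartitions s|, k))%:Z.
Proof.
pose proper F := [forall P in F, proper_bipartition P] && (#|F| == k).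
pose f F x := [ffun P => if P \in F then pblock P x else set0].
transitivity (\sum_(F | proper F) (injectiveb (f F))%:R : int).
  rewrite -natr_sum -big_mkcondr /= sum1dep_card natz; congr Posz.
  rewrite /sigma; apply: eq_card => F; rewrite !inE /proper.
  have [propF|_] := boolP [forall P in F, proper_bipartition P].
    by rewrite (separating_injective propF) /= andbC.
  by rewrite andbF.
under eq_bigr do rewrite -sum_sign_fiber_perm.
rewrite (exchange_big_dep predT) //=; apply: eq_bigr => s _.
(* For fixed [s] the summand is constant, and the families left to count are the [k]-subsets of
   [uncut_bipartitions s]. *)
rewrite sumr_const -mulr_natr natz -cards_draws.
congr (_ * Posz _); apply: eq_card => F; rewrite [in RHS]inE unfold_in.
rewrite /proper andbAC; congr (_ && _); rewrite andbC.
apply/andP/subsetP => [[/forallP fs /forall_inP propF] P PF | sub].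
  rewrite inE propF //=; apply/forallP => x; rewrite /cuts negbK.
  by have /eqP/ffunP/(_ P) := fs x; rewrite !ffunE PF => ->.
split; last by apply/forall_inP => P /sub; rewrite inE => /andP[].
apply/forallP => x; apply/eqP/ffunP => P; rewrite !ffunE.
case: ifP => // /sub; rewrite inE => /andP[_ /forallP/(_ x)].
by rewrite negbK => /eqP.
Qed.

Lemma trivIset_set2C (A : {set T}) : trivIset [set A; ~: A].
Proof.
apply/trivIsetP => B C; rewrite !inE -setI_eq0.
by case/orP => /eqP-> /orP[]/eqP->; rewrite ?eqxx ?setICr // setIC setICr eqxx.
Qed.

Lemma cuts_set2C (A : {set T}) (x y : T) :
  cuts [set A; ~: A] x y = ((x \in A) != (y \in A)).
Proof.
have blockE z : pblock [set A; ~: A] z = if z \in A then A else ~: A.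
  by case: ifP => Az; apply: def_pblock;
    rewrite ?trivIset_set2C ?inE ?Az ?eqxx ?orbT.
have neqAC : (A == ~: A) = false.
  by apply/eqP => /setP/(_ x); rewrite inE; case: (x \in A).
rewrite /cuts !blockE.
by case: (x \in A); case: (y \in A); rewrite ?eqxx // ?neqAC // eq_sym neqAC.
Qed.

(** Naming the block that avoids a base point [x0] removes the choice between [A] and its
    complement, so proper bipartitions can be counted as nonempty sets avoiding [x0]. *)
Lemma proper_bipartitionP P (x0 : T) :
  reflect (exists A : {set T}, [/\ A != set0, x0 \notin A & P = [set A; ~: A]])
          (proper_bipartition P).
Proof.
apply: (iffP idP) => [/andP[/andP[partP _] /cards2P[B [C [neqBC defP]]]] |].
  have PB : B \in P by rewrite defP !inE eqxx.
  have PC : C \in P by rewrite defP !inE eqxx orbT.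
  have BC : [disjoint B & C] := trivIsetP (partition_trivIset partP) B C PB PC neqBC.
  have defC : C = ~: B.
    apply/setP => x; rewrite inE; apply/idP/idP => [Cx|nBx].
      by rewrite (disjointFl BC).
    have : x \in cover P by rewrite (cover_partition partP).
    by rewrite defP /cover big_setU1 ?inE //= big_set1 (negbTE nBx).
  have [Bx0|nBx0] := boolP (x0 \in B).
    exists C; split; rewrite ?(partition_neq0 partP) //.
      by rewrite (disjointFr BC).
    by rewrite defP defC setCK setUC.
  by exists B; split; rewrite ?(partition_neq0 partP) // defP defC.
case=> A [A0 nAx0 ->].
have neqAC : A != ~: A.
  by apply/eqP => /setP/(_ x0); rewrite inE; case: (x0 \in A).
have nCA0 : ~: A != set0 by apply/set0Pn; exists x0; rewrite inE.
rewrite /proper_bipartition /bipartition cards2 neqAC /= !andbT /partition.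
apply/and3P; split.
- by rewrite /cover big_setU1 ?inE //= big_set1 setUCr.
- exact: trivIset_set2C.
- by rewrite !inE negb_or eq_sym A0 eq_sym.
Qed.

Lemma mem_cover_porbits s (D : {set {set T}}) x :
  D \subset porbits s -> (x \in cover D) = (porbit s x \in D).
Proof.
move=> /subsetP sD; apply/bigcupP/idP => [[o Do] ox|Dx]; last first.
  by exists (porbit s x); rewrite ?porbit_id.
have /imsetP[y _ oy] := sD o Do; rewrite oy in ox Do.
by have /eqP-> : porbit s x == porbit s y by rewrite eq_porbit_mem.
Qed.

Lemma mem_invariant_porbit s (A : {set T}) x y :
    (forall z, (s z \in A) = (z \in A)) ->
  y \in porbit s x -> (y \in A) = (x \in A).
Proof.
move=> invA /porbitP[i ->]; elim: i => [|i IHi]; first by rewrite perm1.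
by rewrite expgSr permM invA.
Qed.

(** The block avoiding [x0] is a union of cycles, hence amounts to a nonempty set of cycles other
    than that of [x0]. *)
Lemma card_uncut_bipartitions s (x0 : T) :
  #|uncut_bipartitions s| = (2 ^ #|porbits s|.-1 - 1)%N.
Proof.
pose Ds := powerset (porbits s :\ porbit s x0) :\ set0.
pose f (D : {set {set T}}) := [set cover D; ~: cover D].
have DsP D : D \in Ds ->
    [/\ D != set0, D \subset porbits s & x0 \notin cover D].
  rewrite /Ds !inE subsetD1 => /and3P[D0 sD nDx0].
  by split=> //; rewrite (mem_cover_porbits _ sD).
have f_inj : {in Ds &, injective f}.
  move=> D E /DsP[_ sD nDx0] /DsP[_ sE nEx0] /setP/(_ (cover D)).
  (* [cover D] must be [cover E] or its complement; the latter contains [x0], which [cover D] does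
     not. *)
  rewrite !inE eqxx /= => /esym/orP[/eqP eqc|/eqP/setP/(_ x0)]; last first.
    by rewrite inE (negbTE nDx0) nEx0.
  apply/setP => o; apply/idP/idP => [Do|Eo].
    have /imsetP[x _ def_o] := subsetP sD o Do; rewrite def_o in Do *.
    by rewrite -(mem_cover_porbits x sE) -eqc (mem_cover_porbits x sD).
  have /imsetP[x _ def_o] := subsetP sE o Eo; rewrite def_o in Eo *.
  by rewrite -(mem_cover_porbits x sD) eqc (mem_cover_porbits x sE).
have -> : uncut_bipartitions s = f @: Ds.
  apply/setP => P; rewrite inE; apply/andP/imsetP => [[]|[D /DsP[D0 sD nDx0] ->]].
    case/(proper_bipartitionP _ x0) => A [A0 nAx0 ->] /forallP uncutA.
    have invA z : (s z \in A) = (z \in A).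
      by have := uncutA z; rewrite cuts_set2C negbK => /eqP.
    have subA x : (porbit s x \subset A) = (x \in A).
      apply/subsetP/idP => [-> //|Ax y /(mem_invariant_porbit invA) -> //].
      exact: porbit_id.
    (* As [A] is stable under [s], it is the union of the cycles that it contains. *)
    pose D := [set o in porbits s | o \subset A].
    have sD : D \subset porbits s by apply/subsetP => o; rewrite inE => /andP[].
    have coverD : cover D = A.
      apply/setP => x; rewrite (mem_cover_porbits _ sD) inE subA.
      by rewrite imset_f.
    exists D; last by rewrite /f coverD.
    rewrite /Ds !inE subsetD1 sD inE subA (negbTE nAx0) andbF !andbT.
    by apply: contraNneq A0 => D0; rewrite -coverD D0 /cover big_set0.
  split.
    apply/(proper_bipartitionP _ x0); exists (cover D); split=> //.
    have /set0Pn[o Do] := D0; have /imsetP[x _ def_o] := subsetP sD o Do.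
    by apply/set0Pn; exists x; rewrite (mem_cover_porbits _ sD) -def_o.
  apply/forallP => x; rewrite cuts_set2C negbK !(mem_cover_porbits _ sD).
  by have := porbit_perm s 1 x; rewrite expg1 => ->.
have Px0 : porbit s x0 \in porbits s by apply: imset_f.
rewrite (card_in_imset f_inj) (cardsD1 (porbit s x0) (porbits s)) Px0 /=.
by rewrite -card_powerset (cardsD1 set0 (powerset _)) inE sub0set addKn.
Qed.

End UncutBipartitions.

(** Conjugation by the bijection [h] is injective and maps cycles to their images under [h]. An
    inequality suffices, since [h] and [g] can be exchanged. *)
Lemma leq_card_perm_porbits (T U : finType) (h : T -> U) (g : U -> T) c :
    cancel h g -> cancel g h ->
  (#|[set s : {perm T} | #|porbits s| == c]|
     <= #|[set s : {perm U} | #|porbits s| == c]|)%N.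
Proof.
move=> hK gK.
have inj_conj (s : {perm T}) : injective (fun u => h (s (g u))).
  by move=> u v /(can_inj hK)/perm_inj/(can_inj gK).
pose conj s := perm (inj_conj s).
have conj_inj : injective conj.
  move=> s t /permP eq_st; apply/permP => x.
  by have := eq_st (h x); rewrite !permE !hK => /(can_inj hK).
have conjX s i x : (conj s ^+ i)%g (h x) = h ((s ^+ i)%g x).
  elim: i => [|i IHi]; first by rewrite !perm1.
  by rewrite !expgSr !permM IHi permE hK.
have porbit_conj s x : porbit (conj s) (h x) = h @: porbit s x.
  apply/setP => u; apply/porbitP/imsetP => [[i ->]|[_ /porbitP[i ->] ->]].
    by exists ((s ^+ i)%g x); rewrite ?mem_porbit ?conjX.
  by exists i; rewrite conjX.
have porbits_conj s : porbits (conj s) = [set h @: (o : {set T}) | o in porbits s].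
  apply/setP => o; apply/imsetP/imsetP => [[u _ ->]|[_ /imsetP[x _ ->] ->]].
    by exists (porbit s (g u)); rewrite ?imset_f // -porbit_conj gK.
  by exists (h x); rewrite ?porbit_conj.
rewrite -(card_imset _ conj_inj); apply/subset_leq_card/subsetP => _ /imsetP[s + ->].
rewrite !inE => /eqP <-.
by rewrite porbits_conj (card_imset _ (imset_inj (can_inj hK))).
Qed.

Lemma stirling1_card_perm (T : finType) c :
  stirling1 #|T| c = #|[set s : {perm T} | #|porbits s| == c]|.
Proof.
apply/eqP; rewrite eqn_leq (leq_card_perm_porbits _ (@enum_valK T) (@enum_rankK T)).
exact: leq_card_perm_porbits (@enum_rankK T) (@enum_valK T).
Qed.

Theorem theorem3p15 (n k : nat) (T : finType) (hT : #|T| = n)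
    (hn : (2 <= n)%N) (hk1 : (1 <= k)%N) (hk2 : (k < 2 ^ (n - 1))%N) :
  (sigma T k)%:Z =
    \sum_(1 <= i < n)
      (-1) ^+ (n - 1 - i)%N * (stirling1 n i.+1)%:Z * ('C(2 ^ i - 1, k))%:Z.
Proof.
case: n hT hn {hk2} => // n hT hn.
have /card_gt0P[x0 _] : (0 < #|T|)%N by rewrite hT.
have porb_le (s : {perm T}) : (#|porbits s| <= n.+1)%N.
  by rewrite -hT; apply: leq_imset_card.
have porb_gt0 (s : {perm T}) : (0 < #|porbits s|)%N.
  by apply/card_gt0P; exists (porbit s x0); apply: imset_f.
rewrite sigma_sum_perm.
(* The added term [i = 0], for permutations with a single cycle, vanishes because ['C(0, k)] is 0
   for positive [k]. *)
transitivity (\sum_(0 <= i < n.+1) (-1) ^+ (n.+1 - 1 - i)%N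
    * (stirling1 n.+1 i.+1)%:Z * ('C(2 ^ i - 1, k))%:Z); last first.
  rewrite big_ltn // expn0 subnn bin0n.
  by rewrite eqn0Ngt hk1 mulr0 add0r.
(* Permutations are grouped by their number of cycles minus one; that number lies between 1 and
   [n.+1], so [inord] never takes its default value. *)
rewrite big_mkord (partition_big (fun s : {perm T} =>
  inord #|porbits s|.-1 : 'I_n.+1) predT) //=.
apply: eq_bigr => i _.
have -> : stirling1 n.+1 i.+1 = #|[set s : {perm T} | #|porbits s| == i.+1]|.
  by move: (nat_of_ord i) => j; rewrite -hT stirling1_card_perm.
rewrite mulrAC -[X in _ * X]natz mulr_natr -sumr_const.
have porbitsE (s : {perm T}) :
    (inord #|porbits s|.-1 == i) = (#|porbits s| == i.+1).
  rewrite -(inj_eq val_inj) /= inordK ?prednK ?porb_le //.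
  by rewrite -[in RHS](prednK (porb_gt0 s)).
apply: eq_big => [s | s]; rewrite porbitsE ?inE // => /eqP card_s.
rewrite (card_uncut_bipartitions s x0) card_s /=; congr (_ * _).
(* [odd_perm] is the parity of the number of points plus the number of cycles, here [n.+1] and
   [i.+1], which is the parity of [n - i]. *)
rewrite /odd_perm hT card_s oddS addNb addbN negbK -signr_odd.
by rewrite subSS subn0 oddb -[RHS]signr_odd oddB -1?ltnS.
Qed.
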